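(* Let $A$ be an alphabet, let $F_A$ be the free group on $A$, and let $H\leqslant K\leqslant F_A$ be subgroups. Then the following are equivalent: (a) $H$ is not contained in any proper free factor of $K$ (i.e. $H\leqslant K$ is an algebraic extension); (b) for every free group $F_B$ and every injective homomorphism $F_A\hookrightarrow F_B$ (through which $H,K$ are regarded as subgroups of $F_B$), every subgroup $L\leqslant F_B$ containing $K$, and every basis $C'$ of $L$, the $C'$-homomorphism $\theta_{H,K}\colon \Gamma_{C'}(H)\to \Gamma_{C'}(K)$ is onto; (c) for every alphabet $B\supseteq A$ (so that $F_A\leqslant F_B$), every subgroup $L\leqslant F_B$ containing $K$, and every basis $C'$ of $L$, the $C'$-homomorphism $\theta_{H,K}\colon \Gamma_{C'}(H)\to \Gamma_{C'}(K)$ is onto; (d) for every subgroup $L\leqslant F_A$ containing $K$, and every basis $C'$ of $L$, the $C'$-homomorphism $\theta_{H,K}\colon \Gamma_{C'}(H)\to \Gamma_{C'}(K)$ is onto; (e) for every basis $C'$ of $K$, the $C'$-homomorphism $\theta_{H,K}\colon \Gamma_{C'}(H)\to \Gamma_{C'}(K)$ is onto.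
   Context: Subgroups are not assumed finitely generated, and the alphabets $B$ and bases $C'$ may be infinite. Free factor: $M\leqslant K$ is a free factor of $K$ if some (equivalently, any) basis of $M$ can be extended to a basis of $K$. Stallings automata. Let $F$ be a free group with basis $C$. An involutive $C$-automaton is a directed graph (loops and parallel edges allowed) with edges labelled by elements of $C\cup C^{-1}$, with a distinguished vertex $\circledcirc$ (the basepoint), in which every edge $e$ from $p$ to $q$ labelled $c$ has an inverse edge $e^{-1}$ from $q$ to $p$ labelled $c^{-1}$. It is deterministic if no two different edges with the same label start (or end) at the same vertex. A path is reduced if it never crosses an edge immediately followed by its inverse. The automaton is trim if every vertex and edge appears in some reduced closed path at $\circledcirc$. A Stallings $C$-automaton is a connected, deterministic, trim involutive $C$-automaton. For each subgroup $H\leqslant F$ there is a unique (up to isomorphism) Stallings $C$-automaton $\Gamma_C(H)$ such that the set of labels of reduced closed paths at $\circledcirc$, read in $F$, is exactly $H$; it is the Stallings graph of $H$ with respect to $C$. A $C$-homomorphism between $C$-automata is a map sending vertices to vertices and edges to edges, preserving incidence, labels and basepoint. It is onto if it is surjective both on vertices and on edges. For $H\leqslant K\leqslant F$ there is a unique $C$-homomorphism $\theta_{H,K}\colon \Gamma_C(H)\to\Gamma_C(K)$. When $C'$ is a basis of a free group $L$ and $H\leqslant K\leqslant L$, the graphs $\Gamma_{C'}(H)$ and $\Gamma_{C'}(K)$ are the Stallings graphs of $H$ and $K$ as subgroups of $L$ with respect to $C'$. *)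

(* Defs.v *)
From Stdlib Require List.
From HB Require Import structures.
From mathcomp Require Import all_boot all_order boolp classical_sets.

Set Implicit Arguments.
Unset Strict Implicit.
Unset Printing Implicit Defensive.

Local Open Scope group_scope.
Local Open Scope classical_set_scope.

(* The letter [(a, true)] stands for [a] and [(a, false)] for its inverse. The
   alphabet is an arbitrary type; [{classic A}] gives it classical equality. *)
Definition letter (A : Type) : Type := ({classic A} * bool)%type.

Definition letter_inv A (x : letter A) : letter A := (x.1, ~~ x.2).

Definition reduced_word A (w : seq (letter A)) : bool :=
  sorted (fun x y => y != letter_inv x) w.

Record free_group (A : Type) :=
  FreeGroup { word : seq (letter A); word_reduced : reduced_word word }.

HB.instance Definition _ A := [isSub for @word A].
HB.instance Definition _ A := [Choice of free_group A by <:].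

Section FreeGroup.

Variable A : Type.
Implicit Types (x y : letter A) (s t : seq (letter A)) (u v w : free_group A).

Lemma letter_invK : involutive (@letter_inv A).
Proof. by case=> a b; rewrite /letter_inv /= negbK. Qed.

Lemma letter_inv_neq x : (letter_inv x == x) = false.
Proof. by case: x => a b; rewrite xpair_eqE eqxx /=; case: b. Qed.

Definition cons_red x s : seq (letter A) :=
  if s is y :: s' then if y == letter_inv x then s' else x :: s else [:: x].

Lemma cons_red_reduced x s : reduced_word s -> reduced_word (cons_red x s).
Proof.
case: s => //= y s ys; case: eqP => [_|/eqP yx]; last by rewrite /= yx.
exact: path_sorted ys.
Qed.

Lemma cons_redK x s :
  reduced_word s -> cons_red x (cons_red (letter_inv x) s) = s.
Proof.
case: s => /= [|y s ys]; first by rewrite eqxx.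
rewrite letter_invK; case: eqP => [<-|_] /=; last by rewrite eqxx.
by case: s ys => //= z s /andP[/negbTE -> _].
Qed.

Lemma cons_redKV x s :
  reduced_word s -> cons_red (letter_inv x) (cons_red x s) = s.
Proof. by move=> sr; rewrite -[x in cons_red x s]letter_invK cons_redK. Qed.

Definition mul_word s t := foldr cons_red t s.

Lemma mul_word_reduced s t : reduced_word t -> reduced_word (mul_word s t).
Proof. by move=> tr; elim: s => //= x s; exact: cons_red_reduced. Qed.

Lemma mul_cons_red x s t : reduced_word t ->
  mul_word (cons_red x s) t = cons_red x (mul_word s t).
Proof.
move=> tr; case: s => //= y s; case: eqP => //= ->.
by rewrite cons_redK ?mul_word_reduced.
Qed.

Lemma mul_wordA r s t : reduced_word t ->
  mul_word r (mul_word s t) = mul_word (mul_word r s) t.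
Proof. by move=> tr; elim: r => //= x r ->; rewrite mul_cons_red. Qed.

Lemma mul_word_nil s : reduced_word s -> mul_word s [::] = s.
Proof.
elim: s => //= x s IHs xs; rewrite IHs; last exact: path_sorted xs.
by case: s xs {IHs} => //= y s /andP[/negbTE -> _].
Qed.

Definition inv_word s := rev (map (@letter_inv A) s).

Lemma inv_word_reduced s : reduced_word s -> reduced_word (inv_word s).
Proof.
rewrite /reduced_word /inv_word rev_sorted sorted_map; apply: sub_sorted => x y.
by apply: contra_neq => /= /(can_inj letter_invK) ->; rewrite letter_invK.
Qed.

Lemma mul_inv_word s t : reduced_word t -> mul_word (inv_word s) (mul_word s t) = t.
Proof.
move=> tr; elim: s => //= x s IHs.
rewrite /inv_word /= rev_cons /mul_word foldr_rcons -/(mul_word _ _).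
by rewrite cons_redKV ?mul_word_reduced.
Qed.

Definition fg_one : free_group A := @FreeGroup A [::] isT.
Definition fg_mul u v : free_group A :=
  FreeGroup (mul_word_reduced (word u) (word_reduced v)).
Definition fg_inv u : free_group A := FreeGroup (inv_word_reduced (word_reduced u)).

Lemma fg_mulA : associative fg_mul.
Proof. by move=> u v w; apply/val_inj/mul_wordA/word_reduced. Qed.

Lemma fg_mul1 : left_id fg_one fg_mul.
Proof. by move=> u; apply/val_inj. Qed.

Lemma fg_mulr1 : right_id fg_one fg_mul.
Proof. by move=> u; apply/val_inj/mul_word_nil/word_reduced. Qed.

Lemma fg_mulV : left_inverse fg_one fg_inv fg_mul.
Proof.
move=> u; apply/val_inj.
by rewrite /= -[X in mul_word _ X]mul_word_nil ?word_reduced// mul_inv_word.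
Qed.

Lemma fg_mulrV : right_inverse fg_one fg_inv fg_mul.
Proof.
move=> u; rewrite -[LHS]fg_mul1 -(fg_mulV (fg_inv u)) -fg_mulA.
by rewrite (fg_mulA (fg_inv u)) fg_mulV fg_mul1.
Qed.

HB.instance Definition _ :=
  isGroup.Build (free_group A) fg_mulA fg_mul1 fg_mulr1 fg_mulV fg_mulrV.

Definition free_gen (a : A) : free_group A := @FreeGroup A [:: (a, true)] isT.

End FreeGroup.

Section FreeLift.

Variables (A : Type) (G : groupType) (f : A -> G).

Definition letter_val (x : letter A) : G := if x.2 then f x.1 else (f x.1)^-1.

Definition free_lift (w : free_group A) : G := \prod_(x <- word w) letter_val x.

Lemma letter_valV x : letter_val (letter_inv x) = (letter_val x)^-1.
Proof. by case: x => a [] //=; rewrite /letter_val /= invgK. Qed.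

Lemma free_liftM : {morph free_lift : u v / u * v}.
Proof.
move=> u v; rewrite /free_lift /=; elim: (word u) => [|x s IHs] /=.
  by rewrite big_nil mul1g.
rewrite big_cons -mulgA -{}IHs; case: mul_word => [|y t] /=.
  by rewrite big_seq1 big_nil mulg1.
case: eqP => [->|_]; last by rewrite big_cons.
by rewrite big_cons letter_valV mulVKg.
Qed.

Lemma free_liftF : {morph free_lift : u v / u / v}.
Proof. by move=> u v; apply: (mulIg (free_lift v)); rewrite -free_liftM !mulgVK. Qed.

HB.instance Definition _ :=
  isGroupMorphism.Build (free_group A) G free_lift free_liftF.

Lemma free_lift_gen a : free_lift (free_gen a) = f a.
Proof. by rewrite /free_lift big_seq1. Qed.

End FreeLift.

Definition free_map (A B : Type) (i : A -> B) : free_group A -> free_group B :=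
  free_lift (fun a => free_gen (i a)).

Section Subgroups.

Variable G : groupType.
Implicit Types (C H K L M : set G).

Definition subgroup H : Prop := group_closed [in H].

(* [C] is a basis of [L]: the inclusion of [C] extends to an isomorphism from
   the free group on [C] onto [L]. *)
Definition is_basis L C : Prop :=
  injective (free_lift (fun c : C => val c)) /\
  range (free_lift (fun c : C => val c)) = L.

Definition free_factor M K : Prop :=
  exists C D : set G, [/\ is_basis M C, is_basis K D & C `<=` D].

End Subgroups.

(* The alphabet is a subset [C] of a group [G] (in use, a basis of a subgroup of
   [G]) and labels are elements of [G], so that reading the label of a path in
   the group means taking the product of the labels of its edges. *)
Record automaton (G : groupType) (C : set G) := Automaton {
  vertex : Type;
  edge : Type;
  basepoint : vertex;
  src : edge -> vertex;
  tgt : edge -> vertex;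
  label : edge -> G;
  inv_edge : edge -> edge;
  label_in : forall e, C (label e) \/ C (label e)^-1;
  src_inv : forall e, src (inv_edge e) = tgt e;
  tgt_inv : forall e, tgt (inv_edge e) = src e;
  label_inv : forall e, label (inv_edge e) = (label e)^-1;
  inv_edgeK : involutive inv_edge
}.

Arguments basepoint {G C}.
Arguments inv_edge {G C} _ _.

Section Automata.

Variables (G : groupType) (C : set G).

Section Paths.

Variable X : automaton C.
Implicit Types (p q : vertex X) (e : edge X) (s : seq (edge X)).

Fixpoint is_path p s q : Prop :=
  if s is e :: s' then src e = p /\ is_path (tgt e) s' q else p = q.

Definition reduced s : Prop :=
  forall s1 e e' s2, s = s1 ++ [:: e, e' & s2] -> e' <> inv_edge X e.

Definition reduced_closed s : Prop :=
  is_path (basepoint X) s (basepoint X) /\ reduced s.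

Definition path_label s : G := \prod_(e <- s) label e.

(* The basepoint is the only vertex of the empty closed path. *)
Definition vertex_on p s : Prop :=
  p = basepoint X \/ exists2 e, List.In e s & src e = p \/ tgt e = p.

Definition connected : Prop := forall p q, exists s, is_path p s q.

Definition deterministic : Prop := forall e e', label e = label e' ->
  src e = src e' \/ tgt e = tgt e' -> e = e'.

Definition trim : Prop :=
  (forall p, exists2 s, reduced_closed s & vertex_on p s) /\
  (forall e, exists2 s, reduced_closed s & List.In e s).

Definition is_stallings : Prop := [/\ connected, deterministic & trim].

End Paths.

Definition stallings_graph (H : set G) (X : automaton C) : Prop :=
  is_stallings X /\ @path_label X @` [set s | reduced_closed s] = H.

Record automaton_hom (X Y : automaton C) := AutomatonHom {
  hom_vertex : vertex X -> vertex Y;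
  hom_edge : edge X -> edge Y;
  hom_basepoint : hom_vertex (basepoint X) = basepoint Y;
  hom_src : forall e, src (hom_edge e) = hom_vertex (src e);
  hom_tgt : forall e, tgt (hom_edge e) = hom_vertex (tgt e);
  hom_label : forall e, label (hom_edge e) = label e
}.

Definition hom_onto X Y (f : automaton_hom X Y) : Prop :=
  range (hom_vertex f) = setT /\ range (hom_edge f) = setT.

(* Stallings graphs are defined up to isomorphism, so the statement
   quantifies over all of them; [stallings_hom_exists] below shows that for
   subgroups [H <= K] of the group with basis [C] it is not vacuous. *)
Definition stallings_hom_onto (H K : set G) : Prop :=
  forall X Y, stallings_graph H X -> stallings_graph K Y ->
  forall f : automaton_hom X Y, hom_onto f.

End Automata.

(* The Stallings graph of [H] is realized as the part of the Schreier graph of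
   the right cosets of [H] that is covered by reduced closed paths at [H]. *)

Section Existence.

Variables (G : groupType) (C : set G).
Implicit Types (a : G) (w u v : seq G) (H K : set G).

Let prod w : G := \prod_(a <- w) a.

Definition label_word w : Prop :=
  (forall a, List.In a w -> C a \/ C a^-1) /\
  (forall u a b v, w = u ++ [:: a, b & v] -> b <> a^-1).

Definition right_coset H a : set G := [set g | H (g * a^-1)].

(* [u] is a prefix of a reduced word [u ++ v] of an element of [H]. *)
Definition core_split H u v : Prop := label_word (u ++ v) /\ H (prod (u ++ v)).

Definition core_vertex H : Type :=
  {p : set G | exists u v, core_split H u v /\ p = right_coset H (prod u)}.

Definition core_edge H : Type :=
  {pa : set G * G | exists u v,
     core_split H u (pa.2 :: v) /\ pa.1 = right_coset H (prod u)}.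

Lemma prod_cat u v : prod (u ++ v) = prod u * prod v.
Proof. exact: big_cat. Qed.

Lemma prod_rcons u a : prod (rcons u a) = prod u * a.
Proof. by rewrite -cats1 prod_cat /prod big_seq1. Qed.

Lemma prod_inv w : prod (rev (map inv w)) = (prod w)^-1.
Proof.
elim: w => [|a w IHw]; first by rewrite /prod !big_nil invg1.
by rewrite /= rev_cons prod_rcons IHw /prod big_cons invgM.
Qed.

Lemma label_word_inv w : label_word w -> label_word (rev (map inv w)).
Proof.
move=> [wC wr]; split.
  move=> a; rewrite -[a]invgK => aw.
  suff /wC : List.In a^-1 w by rewrite invgK; tauto.
  elim: w {wC wr} aw => //= b w IHw; rewrite rev_cons -cats1.
  by case/(List.in_app_or _ _ _) => [/IHw|[/(can_inj (@invgK _))|[]]]; tauto.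
move=> u a b v E ba; apply: (wr (rev (map inv v)) b^-1 a^-1 (rev (map inv u))).
  rewrite -[LHS](mapK (@invgK G)) -[map inv w]revK E rev_cat map_cat.
  by rewrite !rev_cons !map_rcons !map_rev -!cats1 -!catA.
by rewrite ba invgK.
Qed.

Section OneSubgroup.

Variable H : set G.
Hypothesis subgroupH : subgroup H.

Lemma subgroup1 : H 1.
Proof. by have [/set_mem] := subgroupH. Qed.

Lemma subgroupV a : H a -> H a^-1.
Proof.
move=> aH; have [_ /(_ 1 a)] := subgroupH.
by rewrite !inE mul1g => /(_ subgroup1 aH).
Qed.

Lemma subgroupM a b : H a -> H b -> H (a * b).
Proof.
move=> aH /subgroupV bH; have [_ /(_ a b^-1)] := subgroupH.
by rewrite !inE invgK => /(_ aH bH).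
Qed.

Lemma right_cosetP a b : right_coset H a = right_coset H b <-> H (a * b^-1).
Proof.
split=> [/seteqP[/(_ a) + _]|ab]; first by apply; rewrite /right_coset/= mulgV; exact: subgroup1.
apply/seteqP; split=> g; rewrite /right_coset/= => gH.
  by rewrite -(mulgVK a g) -mulgA; apply: subgroupM.
rewrite -(mulgVK b g) -mulgA; apply: subgroupM => //.
by rewrite -[b * _]invgK invgM invgK; apply: subgroupV.
Qed.

Lemma core_split_rcons u a v :
  core_split H u (a :: v) -> core_split H (rcons u a) v.
Proof. by rewrite /core_split cat_rcons. Qed.

Lemma core_split_inv u v :
  core_split H u v -> core_split H (rev (map inv v)) (rev (map inv u)).
Proof.
rewrite /core_split -rev_cat -map_cat prod_inv => -[/label_word_inv uv uvH].
by split=> //; exact: subgroupV.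
Qed.

Lemma right_coset_inv u v : core_split H u v ->
  right_coset H (prod (rev (map inv v))) = right_coset H (prod u).
Proof.
move=> [_]; rewrite prod_cat prod_inv => /subgroupV uvH; apply/right_cosetP.
by rewrite -invgM.
Qed.

Lemma core_vertex_inj (p q : core_vertex H) : sval p = sval q -> p = q.
Proof. by case: p q => p hp [q hq] /=; exact: eq_exist. Qed.

Lemma core_edge_inj (e e' : core_edge H) : sval e = sval e' -> e = e'.
Proof. by case: e e' => e he [e' he'] /=; exact: eq_exist. Qed.

Definition core_src_subproof (e : core_edge H) :
  exists u v, core_split H u v /\ (sval e).1 = right_coset H (prod u).
Proof. by have [u [v [uv ->]]] := svalP e; exists u, ((sval e).2 :: v). Qed.

Definition core_src (e : core_edge H) : core_vertex H :=
  exist _ _ (core_src_subproof e).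

Definition translate (p : set G) a : set G := [set g | p (g * a^-1)].

Lemma translate_coset a b :
  translate (right_coset H a) b = right_coset H (a * b).
Proof. by apply/seteqP; split=> g; rewrite /translate/right_coset/= invgM mulgA. Qed.

Lemma translateK a p : translate (translate p a) a^-1 = p.
Proof. by apply/seteqP; split=> g; rewrite /translate/= invgK mulgK. Qed.

Definition core_inv_subproof (e : core_edge H) : exists u v,
  core_split H u ((sval e).2^-1 :: v) /\
  translate (sval e).1 (sval e).2 = right_coset H (prod u).
Proof.
have [u [v [uv ->]]] := svalP e.
exists (rev (map inv v)), (rev (map inv u)); split.
  by have := core_split_inv uv; rewrite /= rev_cons /core_split cat_rcons.
by rewrite translate_coset (right_coset_inv (core_split_rcons uv)) prod_rcons.
Qed.

Definition core_inv (e : core_edge H) : core_edge H :=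
  exist _ (translate (sval e).1 (sval e).2, (sval e).2^-1) (core_inv_subproof e).

Definition core_base : core_vertex H.
Proof.
exists H, [::], [::]; split; first split.
- by split=> // -[].
- by rewrite /prod big_nil; exact: subgroup1.
- by apply/seteqP; split=> g; rewrite /right_coset/= /prod big_nil invg1 mulg1.
Defined.

Lemma core_label_in (e : core_edge H) : C (sval e).2 \/ C (sval e).2^-1.
Proof.
have [u [v [[[+ _] _] _]]] := svalP e; apply.
by apply: List.in_or_app; right; left.
Qed.

Lemma core_invK : involutive core_inv.
Proof. by case=> -[p a] pa; apply: eq_exist => /=; rewrite translateK invgK. Qed.

Lemma core_tgt_inv e : core_src (core_inv (core_inv e)) = core_src e.
Proof. by rewrite core_invK. Qed.

Definition core_graph : automaton C :=
  @Automaton G C _ _ core_base core_src (fun e => core_src (core_inv e))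
    (fun e => (sval e).2) core_inv core_label_in (fun=> erefl)
    core_tgt_inv (fun=> erefl) core_invK.

Local Notation core_is_path := (@is_path _ _ core_graph).
Local Notation core_label := (@label _ _ core_graph).

Lemma core_path u v w : core_split H u (v ++ w) ->
  forall p q : core_vertex H, sval p = right_coset H (prod u) ->
    sval q = right_coset H (prod (u ++ v)) ->
  exists2 s : seq (edge core_graph), core_is_path p s q & map core_label s = v.
Proof.
elim: v u => [|a v IHv] u uvw p q pE qE.
  by exists [::] => //=; apply: core_vertex_inj; rewrite pE qE cats0.
pose e : core_edge H := exist _ (sval p, a)
  (ex_intro _ u (ex_intro _ (v ++ w) (conj uvw pE))).
have [||s s_path sE] := IHv _ (core_split_rcons uvw) (core_src (core_inv e)) q.
- by rewrite /= pE translate_coset prod_rcons.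
- by rewrite cat_rcons.
by exists (e :: s) => /=; [split=> //; exact: core_vertex_inj | rewrite sE].
Qed.

Lemma core_path_coset s (p q : core_vertex H) a :
  core_is_path p s q -> sval p = right_coset H a ->
  sval q = right_coset H (a * path_label s).
Proof.
elim: s p a => /= [p a -> ->|e s IHs p a [<- /IHs e_s] pE].
  by rewrite /path_label big_nil mulg1.
rewrite /path_label big_cons mulgA; apply: e_s.
by rewrite /= -translate_coset -pE.
Qed.

Lemma core_reduced w (s : seq (edge core_graph)) :
  label_word w -> map core_label s = w -> reduced s.
Proof.
move=> [_ wr] sE s1 e e' s2 s_eq e'E; move: sE; rewrite s_eq map_cat /= => /esym/wr.
by apply; rewrite e'E.
Qed.

Lemma core_closed u v : core_split H u v -> exists s1 s2 p,
  [/\ core_is_path (basepoint core_graph) s1 p, core_is_path p s2 (basepoint core_graph),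
      sval p = right_coset H (prod u), map core_label s1 = u
    & map core_label s2 = v].
Proof.
move=> uv; have cH : H = right_coset H (prod [::]).
  by apply/seteqP; split=> g; rewrite /right_coset/= /prod big_nil invg1 mulg1.
pose p : core_vertex H := exist _ _ (ex_intro _ u (ex_intro _ v (conj uv erefl))).
have [||s1 ? ?] := @core_path [::] u v uv core_base p; first exact: cH.
  by [].
have uv0 : core_split H u (v ++ [::]) by rewrite cats0.
have q_end : sval core_base = right_coset H (prod (u ++ v)).
  rewrite [LHS]cH; apply/right_cosetP.
  by rewrite /prod big_nil mul1g; apply: subgroupV; exact: (proj2 uv).
have [s2 ? ?] := core_path uv0 (erefl : sval p = _) q_end.
by exists s1, s2, p.
Qed.

Lemma is_path_cat (p q r : vertex core_graph) s t :
  core_is_path p s q -> core_is_path q t r -> core_is_path p (s ++ t) r.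
Proof. by elim: s p => /= [p ->|e s IHs p [-> /IHs]] //; split; auto. Qed.

Lemma core_reduced_closed u v s1 s2 p : core_split H u v ->
  core_is_path (basepoint core_graph) s1 p -> core_is_path p s2 (basepoint core_graph) ->
  map core_label s1 = u -> map core_label s2 = v ->
  reduced_closed (s1 ++ s2).
Proof.
move=> uv s1p s2p s1E s2E; split; first exact: is_path_cat s2p.
by case: uv => /core_reduced uv _; apply: uv; rewrite map_cat s1E s2E.
Qed.

Lemma core_connected : connected core_graph.
Proof.
have pathP p : exists s1 s2 : seq (edge core_graph),
    core_is_path core_base s1 p /\ core_is_path p s2 core_base.
  have [u [v [uv pE]]] := svalP p.
  have [s1 [s2 [p' [? ? p'E _ _]]]] := core_closed uv.
  suff -> : p = p' by exists s1, s2.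
  by apply: core_vertex_inj; rewrite pE.
move=> p q; have [_ [s1 [_ ps1]]] := pathP p; have [s2 [_ [qs2 _]]] := pathP q.
by exists (s1 ++ s2); exact: is_path_cat qs2.
Qed.

Lemma core_deterministic : deterministic core_graph.
Proof.
move=> [[p a] pa] [[q b] qb] /= ab pq; apply: core_edge_inj => /=; rewrite -ab; congr pair.
case: pq => [[]//|/(congr1 sval)/= E].
by rewrite -(translateK a p) E -ab translateK.
Qed.

Lemma core_trim : trim core_graph.
Proof.
split=> [p|e].
  have [u [v [uv pE]]] := svalP p.
  have [s1 [s2 [p' [s1p s2p p'E s1E s2E]]]] := core_closed uv.
  have pp' : p = p' by apply: core_vertex_inj; rewrite pE.
  exists (s1 ++ s2); first exact: core_reduced_closed uv s1p s2p s1E s2E.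
  case: s2 s2p {s2E} => [/= p'0|e s2 [eE _]]; first by left; rewrite pp'.
  right; exists e; last by left; rewrite pp'.
  by apply: List.in_or_app; right; left.
have [u [v [uv eE]]] := svalP e.
have [s1 [[|e' s2] [p' [s1p s2p p'E s1E s2E]]]] := core_closed uv => //.
exists (s1 ++ e' :: s2); first exact: core_reduced_closed uv s1p s2p s1E s2E.
suff -> : e = e' by apply: List.in_or_app; right; left.
apply: core_deterministic; first by case: s2E.
by left; case: s2p => -> _; apply: core_vertex_inj; rewrite p'E.
Qed.

Hypothesis generates : forall h, H h -> exists2 w, label_word w & prod w = h.

Lemma core_stallings : stallings_graph H core_graph.
Proof.
split; first by split; [exact: core_connected|exact: core_deterministic|exact: core_trim].
apply/seteqP; split=> h.
  move=> [s [s_path _] <-].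
  have cH : H = right_coset H 1.
    by apply/seteqP; split=> g; rewrite /right_coset/= invg1 mulg1.
  have /= := core_path_coset s_path cH; rewrite mul1g [X in X = _]cH.
  by move=> /right_cosetP; rewrite mul1g => /subgroupV; rewrite invgK.
move=> /[dup] hH /generates[w ww wh].
have wH : core_split H [::] w by split=> //; rewrite /= wh.
have [s1 [s2 [p [s1p s2p _ s1E s2E]]]] := core_closed wH.
exists (s1 ++ s2); first exact: core_reduced_closed wH s1p s2p s1E s2E.
by rewrite /path_label -(big_map _ xpredT id) map_cat s1E s2E.
Qed.

End OneSubgroup.

Section TwoSubgroups.

Variables H K : set G.
Hypotheses (subgroupH : subgroup H) (subgroupK : subgroup K) (HK : H `<=` K).

Definition saturate (p : set G) : set G :=
  [set g | exists2 k, K k & p (k^-1 * g)].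

Lemma saturate_coset a : saturate (right_coset H a) = right_coset K a.
Proof.
apply/seteqP; split=> g; rewrite /saturate /right_coset /=.
  move=> [k kK /HK]; rewrite -mulgA => /(subgroupM subgroupK kK).
  by rewrite mulVKg.
move=> gK; exists (g * a^-1) => //.
by rewrite invgM invgK mulgVK mulgV; apply: subgroup1.
Qed.

Lemma core_splitS u v : core_split H u v -> core_split K u v.
Proof. by move=> [? /HK]. Qed.

Definition core_hom_vertex (p : core_vertex H) : core_vertex K.
Proof.
exists (saturate (sval p)); have [u [v [uv ->]]] := svalP p.
by exists u, v; rewrite saturate_coset; split=> //; exact: core_splitS.
Defined.

Definition core_hom_edge (e : core_edge H) : core_edge K.
Proof.
exists (saturate (sval e).1, (sval e).2); have [u [v [uv /= ->]]] := svalP e.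
by exists u, v; rewrite saturate_coset; split=> //; exact: core_splitS.
Defined.

Lemma core_hom :
  automaton_hom (core_graph subgroupH) (core_graph subgroupK).
Proof.
exists core_hom_vertex core_hom_edge => //=.
- apply: eq_exist => /=; have cosetE L : L = right_coset L 1.
    by apply/seteqP; split=> g; rewrite /right_coset/= invg1 mulg1.
  by rewrite [X in saturate X]cosetE saturate_coset -cosetE.
- by move=> e; apply: eq_exist.
move=> e; apply: eq_exist => /=; have [u [v [uv ->]]] := svalP e.
by rewrite saturate_coset !translate_coset// saturate_coset.
Qed.

End TwoSubgroups.

Lemma basis_word L h : is_basis L C -> L h ->
  exists2 w, label_word w & prod w = h.
Proof.
move=> [inj <-] [g _ <-]; set f := fun c : C => val c.
exists [seq letter_val f x | x <- word g]; last by rewrite /prod big_map.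
split.
  move=> a /List.in_map_iff[[c b] [<- _]]; rewrite /letter_val /=.
  by case: b; rewrite ?invgK; [left|right]; exact/set_mem/(valP c).
move=> u a b v E ba; case: g E => w wr /= E.
have {wr} [x [y [xa yb xy]]] : exists x y : letter C,
    [/\ letter_val f x = a, letter_val f y = b & y != letter_inv x].
  elim: w u wr E => [|x w IHw] [|c u]//= wr [].
  - case: w wr {IHw} => [|y w]//= /andP[xy _] xa [yb _].
    by exists x, y; rewrite xa yb.
  - by move=> _; apply: IHw; exact: path_sorted wr.
have xyr : reduced_word [:: x; y] by rewrite /= xy.
suff /(congr1 (@word _)) : FreeGroup xyr = fg_one _ by [].
apply: inj; rewrite /free_lift /= big_nil big_cons big_seq1 -/f xa yb ba.
exact: mulgV.
Qed.

Theorem stallings_hom_exists L H K : is_basis L C ->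
  subgroup H -> subgroup K -> H `<=` K -> K `<=` L ->
  exists (X Y : automaton C) (_ : automaton_hom X Y),
    stallings_graph H X /\ stallings_graph K Y.
Proof.
move=> LC sH sK HK KL; exists (core_graph sH), (core_graph sK), (core_hom sH sK HK).
by split; apply: core_stallings => h hH; apply: (basis_word LC); auto.
Qed.

End Existence.

(* Main.v *)
From Stdlib Require List.
From HB Require Import structures.
Require Import Defs.
From mathcomp Require Import all_boot all_order boolp classical_sets.

Set Implicit Arguments.
Unset Strict Implicit.
Unset Printing Implicit Defensive.

Local Open Scope group_scope.
Local Open Scope classical_set_scope.

(* (a) implies (b): let E be the set of edges of Gamma(K) in the image of
   Gamma(H). A spanning tree of the subgraph E extends to a spanning tree of
   Gamma(K), so the labels of the closed paths inside E form a free factor M of K,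
   and M contains H. By (a), M = K, so every reduced closed path of Gamma(K), being
   determined by its label, lies inside E; as Gamma(K) is trim, E is everything.
   (e) implies (a): if H <= M, where C is a basis of M and D a basis of K containing
   C, then the labels occurring in Gamma_D(H) are in C or inverse to elements of C,
   whereas each element of D labels an edge of Gamma_D(K). So D = C and M = K. *)

(** * Free groups: functoriality and transport of bases *)

Lemma gmulf_free_lift A (G1 G2 : groupType) (f : UMagmaMorphism.type G1 G2)
  (h : A -> G1) w : f (free_lift h w) = free_lift (f \o h) w.
Proof.
rewrite /free_lift gmulf_prod; apply: eq_bigr => -[a []] _ //=.
exact: gmulfV.
Qed.

Lemma free_lift_map A B (G : groupType) (i : A -> B) (h : B -> G) w :
  free_lift h (free_map i w) = free_lift (h \o i) w.
Proof.
rewrite /free_map (gmulf_free_lift (free_lift h)); congr free_lift.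
by apply/funext => a /=; rewrite free_lift_gen.
Qed.

Lemma free_lift_id A (w : free_group A) : free_lift (@free_gen A) w = w.
Proof.
apply: val_inj => /=; rewrite -[RHS]mul_word_nil ?word_reduced// /free_lift.
elim: (word w) => [|[a b] s IHs]; first by rewrite big_nil.
by rewrite big_cons /= -IHs; case: b.
Qed.

Lemma free_map_inj A B (i : A -> B) : injective i -> injective (free_map i).
Proof.
(* [r] takes values in the free group, so that letters outside the range of [i] can go to 1 even
   when [A] is empty. *)
move=> i_inj; have [r ri] : {r : B -> free_group A & forall b a, i a = b -> r b = free_gen a}.
  apply: (@choice _ _ (fun b x => forall a, i a = b -> x = free_gen a)) => b.
  have [[a <-]|nab] := pselect (exists a, i a = b).
    by exists (free_gen a) => a' /i_inj ->.
  by exists 1 => a ab; case: nab; exists a.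
apply: (can_inj (g := free_lift r)) => w; rewrite free_lift_map -[RHS]free_lift_id.
by congr free_lift; apply/funext => a; exact: ri.
Qed.

(** Serves to carry a free factor found in [G2] back to [G1]: [phi] restricts to an isomorphism from
    the preimage of [L] onto [L], and matches the preimage of [D] with [D]. *)
Lemma basis_preimage (G1 G2 : groupType) (phi : UMagmaMorphism.type G1 G2)
    (L D : set G2) : injective phi -> L `<=` range phi -> is_basis L D ->
  is_basis (phi @^-1` L) (phi @^-1` D).
Proof.
move=> phi_inj Lphi [D_inj DL].
have D_phi c : D c -> exists x, phi x = c.
  move=> Dc; have /Lphi[x _ xc] : L c; last by exists x.
  by rewrite -DL; exists (free_gen (exist _ c (mem_set Dc))); rewrite ?free_lift_gen.
pose j (x : phi @^-1` D) : D := exist _ (phi (val x)) (mem_set (set_mem (valP x))).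
have jE w : free_lift (fun c : D => val c) (free_map j w) =
    phi (free_lift (fun c : phi @^-1` D => val c) w).
  by rewrite free_lift_map gmulf_free_lift.
have j_inj : injective j by move=> x y /(congr1 val) /phi_inj/val_inj.
split=> [u v uv|].
  by apply: (free_map_inj j_inj); apply: D_inj; rewrite !jE uv.
apply/seteqP; split=> [_ [w _ <-]|x]; first by rewrite /preimage/= -jE -DL; exists (free_map j w).
rewrite /preimage/= -DL => -[w _ wx].
have [k jk] : {k : D -> phi @^-1` D & forall c, j (k c) = c}.
  apply: (@choice _ _ (fun c x => j x = c)) => c.
  have [y yc] := D_phi _ (set_mem (valP c)).
  have Dy : (phi @^-1` D) y by rewrite /preimage/= yc; exact: set_mem (valP c).
  by exists (exist _ y (mem_set Dy)); exact: val_inj.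
exists (free_map k w) => //; apply: phi_inj; rewrite -jE -wx; congr free_lift.
rewrite /free_map (free_lift_map k) -[RHS]free_lift_id; congr free_lift.
by apply/funext => c /=; rewrite jk.
Qed.

(** * Reduced words over a basis *)

Section LabelWords.

Variables (G : groupType) (C : set G).

Lemma label_wordW a w : label_word C (a :: w) -> label_word C w.
Proof.
move=> [wC wr]; split=> [b bw|u b c v E]; first by apply: wC; right.
by apply: (wr (a :: u) b c v); rewrite E.
Qed.

(** Mutually inverse letters have mutually inverse values, so any choice of letters representing a
    label word is already reduced. *)
Lemma label_word_lift w : label_word C w ->
  exists g : free_group C, map (letter_val (fun c : C => val c)) (word g) = w.
Proof.
elim: w => [|a w IHw] wC; first by exists 1.
have [g gw] := IHw (label_wordW wC).
have [x xa] : exists x : letter C, letter_val (fun c : C => val c) x = a.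
  have [Ca|Ca] := wC.1 a (or_introl erefl).
    by exists (exist _ a (mem_set Ca), true).
  by exists (exist _ a^-1 (mem_set Ca), false); rewrite /letter_val/= invgK.
suff xg : reduced_word (x :: word g) by exists (FreeGroup xg) => /=; rewrite xa gw.
case: g gw => -[|y s] //= ys gw; apply/andP; split=> //.
apply/eqP => yx; have [_] := wC.
rewrite -gw => /(_ [::] _ _ _ erefl); apply.
by rewrite yx letter_valV xa.
Qed.

Hypothesis C_inj : injective (free_lift (fun c : C => val c)).

Lemma label_word_uniq w w' : label_word C w -> label_word C w' ->
  \prod_(a <- w) a = \prod_(a <- w') a -> w = w'.
Proof.
move=> /label_word_lift[g <-] /label_word_lift[g' <-].
by rewrite !big_map => /C_inj ->.
Qed.

Lemma basis_notinv c : C c -> ~ C c^-1.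
Proof.
move=> Cc Cc'; pose x : C := exist _ c (mem_set Cc).
pose y : C := exist _ c^-1 (mem_set Cc').
(* These are one-letter words of opposite signs, hence distinct even if [c] is its own inverse. *)
have /(congr1 (@word _)) // : free_gen x = (free_gen y)^-1.
by apply: C_inj; rewrite gmulfV/= !free_lift_gen/= invgK.
Qed.

End LabelWords.

(** * Paths, free reduction and distance *)

Section PathTheory.

Variables (G : groupType) (C : set G) (Y : automaton C).
Implicit Types (p q r : vertex Y) (e : edge Y) (s : seq (edge Y)).

Lemma is_path_cat p q r s s' :
  is_path p s q -> is_path q s' r -> is_path p (s ++ s') r.
Proof. by elim: s p => /= [p ->|e s IHs p [-> /IHs]] //; split; auto. Qed.

Lemma is_path_split p r s s' :
  is_path p (s ++ s') r -> exists2 q, is_path p s q & is_path q s' r.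
Proof.
elim: s p => /= [|e s IHs] p; first by exists p.
by move=> [ep /IHs[q sq s'r]]; exists q.
Qed.

Definition inv_path s : seq (edge Y) := rev (map (inv_edge Y) s).

Lemma is_path_inv p q s : is_path p s q -> is_path q (inv_path s) p.
Proof.
rewrite /inv_path; elim: s p => /= [|e s IHs] p; first by move->.
move=> [<- /IHs es]; rewrite rev_cons -cats1; apply: is_path_cat es _ => /=.
by rewrite src_inv tgt_inv.
Qed.

Lemma Forall_inv_path (E : set (edge Y)) s :
  (forall e, E e -> E (inv_edge Y e)) -> List.Forall E s -> List.Forall E (inv_path s).
Proof.
move=> EV; rewrite /inv_path; elim=> //= e s' Ee _ IH.
by rewrite rev_cons -cats1; apply/List.Forall_app; split=> //; constructor; auto.
Qed.

(** The condition under which products along paths survive the deletion of an edge followed by its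
    inverse. *)
Definition edge_weight (W : groupType) (f : edge Y -> W) :=
  forall e, f (inv_edge Y e) = (f e)^-1.

Lemma edge_weight_inv (W : groupType) (f : edge Y -> W) s :
  edge_weight f -> \prod_(e <- inv_path s) f e = (\prod_(e <- s) f e)^-1.
Proof.
move=> fV; rewrite /inv_path; elim: s => [|e s IHs]; first by rewrite !big_nil invg1.
by rewrite /= rev_cons -cats1 big_cat big_seq1 big_cons IHs invgM fV.
Qed.

Lemma Forall_setT s : List.Forall setT s.
Proof. by elim: s => //; constructor. Qed.

(** Backtracks are deleted one at a time. A single [s'] serves all weights, so that labels in [G]
    and readings in a free group can be compared on the same reduced path. *)
Lemma path_reduce p q s (E : set (edge Y)) : is_path p s q -> List.Forall E s ->
  exists s', [/\ reduced s', is_path p s' q, List.Forall E s' &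
    forall (W : groupType) (f : edge Y -> W), edge_weight f ->
      \prod_(e <- s') f e = \prod_(e <- s) f e].
Proof.
have [n] := ubnP (size s); elim: n s => // n IHn s sn sp sE.
have [s_red|/existsNP[s1 /existsNP[e /existsNP[e' /existsNP[s2]]]]] := pselect (reduced s).
  by exists s.
move=> /not_implyP[s_eq /contrapT e'E]; rewrite {}e'E in s_eq.
rewrite {}s_eq in sn sp sE *.
have [r s1r [er [_ s2q]]] := is_path_split sp.
have /List.Forall_app[E1 /List.Forall_cons_iff[_ /List.Forall_cons_iff[_ E2]]] := sE.
have [|||s' [s'r s'p s'E s'f]] := IHn (s1 ++ s2).
- by move: sn; rewrite !size_cat /= !addnS => /ltnW.
- by apply: is_path_cat s1r _; move: s2q; rewrite tgt_inv er.
- by apply/List.Forall_app.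
exists s'; split=> // W f fV; rewrite s'f// !big_cat /= !big_cons fV.
by rewrite mulVKg.
Qed.

(** By determinism, the only edge that can follow [e] with the inverse label is the inverse of
    [e]. *)
Lemma label_word_path p q s : deterministic Y -> is_path p s q -> reduced s ->
  label_word C (map (@label _ _ Y) s).
Proof.
move=> Y_det sp s_red; split=> [a|u a b v].
  by case/List.in_map_iff => e [<- _]; exact: label_in.
move=> s_eq ba.
have [s1 [e [e' [s2 [s_eq' ea e'b]]]]] : exists s1 e e' s2,
    [/\ s = s1 ++ [:: e, e' & s2], label e = a & label e' = b].
  elim: s u s_eq {sp s_red} => [[]//|e s IHs] [|c u] /=.
    by case: s {IHs} => [|e' s] //= [ea e'b _]; exists [::], e, e', s.
  by case=> _ /IHs[s1 [e1 [e' [s2 [-> ? ?]]]]]; exists (e :: s1), e1, e', s2.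
apply: (s_red _ _ _ _ s_eq'); apply: Y_det; first by rewrite label_inv ea e'b.
left; rewrite src_inv; move: sp; rewrite s_eq' => /is_path_split[r _ /=].
by case=> _ [].
Qed.

Lemma deterministic_path p q q' s s' : deterministic Y ->
  is_path p s q -> is_path p s' q' ->
  map (@label _ _ Y) s = map (@label _ _ Y) s' -> s = s'.
Proof.
move=> Y_det; elim: s p s' => [|e s IHs] p [|e' s'] //= [ep es] [e'p e's'] [ee' ss'].
have E : e = e' by apply: Y_det => //; left; rewrite ep.
by rewrite -E in e's' *; rewrite (IHs _ _ es e's' ss').
Qed.

(** Both label sequences are reduced words over a free generating set with the same value, hence
    equal; determinism then recovers the path from its start. *)
Lemma reduced_path_uniq p q q' s s' :
  injective (free_lift (fun c : C => val c)) -> deterministic Y ->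
  is_path p s q -> is_path p s' q' -> reduced s -> reduced s' ->
  path_label s = path_label s' -> s = s'.
Proof.
move=> C_inj Y_det sp s'p sr s'r ss'; apply: (deterministic_path Y_det sp s'p).
apply: (label_word_uniq C_inj); last by rewrite !big_map.
  exact: label_word_path sp sr.
exact: label_word_path s'p s'r.
Qed.

Fixpoint reach_in (E : set (edge Y)) (V : set (vertex Y)) n : set (vertex Y) :=
  if n is m.+1 then [set q | exists e, [/\ E e, reach_in E V m (src e) & tgt e = q]]
  else V.

Lemma reach_in_path E V n p q s : reach_in E V n p -> is_path p s q -> List.Forall E s ->
  reach_in E V (size s + n) q.
Proof.
elim: s n p => [|e s IHs] n p pn; first by move=> /= <-.
move=> [ep es] /List.Forall_cons_iff[eE sE]; rewrite addSnnS.
by apply: IHs es sE; exists e; rewrite ep.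
Qed.

(** [d] is the distance from [V] along [E], and the edge is the last one of a shortest path. *)
Lemma reach_in_rank E V : exists d : vertex Y -> nat, forall q n, reach_in E V n q ->
  ~ V q -> exists e, [/\ E e, tgt e = q, exists m, reach_in E V m (src e) & (d (src e) < d q)%N].
Proof.
have [d dP] : {d : vertex Y -> nat & forall q, (exists n, reach_in E V n q) ->
    reach_in E V (d q) q /\ forall n, reach_in E V n q -> (d q <= n)%N}.
  apply: (@choice _ _ (fun q d => (exists n, reach_in E V n q) ->
    reach_in E V d q /\ forall n, reach_in E V n q -> (d <= n)%N)) => q.
  (* Unreachable vertices get the dummy distance 0, about which nothing is claimed. *)
  have [[n qn]|nq] := pselect (exists n, reach_in E V n q); last by exists 0%N.
  have exq : exists n, `[< reach_in E V n q >] by exists n; apply/asboolP.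
  exists (ex_minn exq) => _; case: ex_minnP => m /asboolP qm mP; split=> // k qk.
  by apply: mP; apply/asboolP.
exists d => q n qn nVq; have [] := dP q (ex_intro _ n qn).
case dq: (d q) => [|m] // [e [Ee em eq]] _; exists e; split=> //; first by exists m.
by rewrite ltnS; apply: (dP _ _).2 => //; exists m.
Qed.

End PathTheory.

(** * Spanning trees and the basis given by their chords *)

Section Chords.

Variables (G : groupType) (C : set G) (Y : automaton C).
Implicit Types (p q r : vertex Y) (e : edge Y) (s : seq (edge Y)).

Lemma edge_weight_label : edge_weight (@label _ _ Y).
Proof. exact: label_inv. Qed.

(** The Schreier generator of [e]: if [t] reads tree paths from the basepoint, this is the label of
    the loop through the tree to [src e], across [e], and back through the tree. *)
Definition chord (t : vertex Y -> G) e : G := t (src e) * label e / t (tgt e).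

Lemma edge_weight_chord t : edge_weight (chord t).
Proof. by move=> e; rewrite /chord src_inv tgt_inv label_inv !invgM invgK mulgA. Qed.

Lemma prod_chord t p q s : is_path p s q ->
  \prod_(e <- s) chord t e = t p * path_label s / t q.
Proof.
rewrite /path_label; elim: s p => [p ->|e s IHs p [<- /IHs es]].
  by rewrite !big_nil mulg1 mulgV.
by rewrite !big_cons es /chord !mulgA mulgVK.
Qed.

Definition reach (E : set (edge Y)) : set (vertex Y) :=
  [set q | exists2 s, is_path (basepoint Y) s q & List.Forall E s].

Lemma reach_base E : reach E (basepoint Y).
Proof. by exists [::] => //; constructor. Qed.

Lemma reach_tgt E e : E e -> reach E (src e) -> reach E (tgt e).
Proof.
move=> Ee [s sp sE]; exists (s ++ [:: e]); first exact: is_path_cat sp _.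
by apply/List.Forall_app; split=> //; constructor.
Qed.

Lemma reach_in_reach E n : reach_in E [set basepoint Y] n `<=` reach E.
Proof.
elim: n => [_ ->|n IHn _ [e [Ee /IHn + <-]]]; first exact: reach_base.
exact: reach_tgt.
Qed.

(* The tree is recorded by the label [t q] of its path from the basepoint to [q];
   its edges have trivial chord. Tree paths to vertices of the component of the
   basepoint in [E] stay inside [E]. *)
Lemma spanning_tree (E : set (edge Y)) : connected Y ->
  exists2 t : vertex Y -> G, t (basepoint Y) = 1 &
    forall q, exists2 s, is_path (basepoint Y) s q &
      List.Forall [set e | chord t e = 1] s /\ (reach E q -> List.Forall E s).
Proof.
move=> Y_conn; pose b := basepoint Y.
(* [d1] grows the tree inside [E] from the basepoint; [d2] then extends it to the whole graph,
   starting from the component already covered. *)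
have [d1 d1P] := reach_in_rank E [set b].
have [d2 d2P] := reach_in_rank setT (reach E).
pose parent e q := [/\ tgt e = q, q <> b,
  reach E q -> [/\ E e, reach E (src e) & (d1 (src e) < d1 q)%N] &
  ~ reach E q -> reach E (src e) \/ (d2 (src e) < d2 q)%N].
have parentP q : q <> b -> exists e, parent e q.
  move=> qb; have [[s sq sE]|nq] := pselect (reach E q).
    have /= := @reach_in_path _ _ _ E [set b] 0 _ _ _ erefl sq sE.
    move=> /d1P/(_ qb)[e [Ee eq [m /reach_in_reach em] de]]; exists e; split=> // nq.
    by case: nq; exists s.
  have [s sq] := Y_conn b q.
  have /d2P/(_ nq)[e [_ eq _ de]] := reach_in_path (reach_base E : reach_in _ _ 0 _) sq (Forall_setT s).
  by exists e; split=> //; right.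
(* Descent along parents is lexicographic: outside the component [d2] drops until the component is
   entered, and from there on [d1] drops. *)
pose R p q := exists2 e, parent e q & src e = p.
have R_wf : well_founded R.
  have Racc q : reach E q -> Acc R q.
    have [n] := ubnP (d1 q); elim: n q => [q|n IHn q qn Eq]; first by rewrite ltn0.
    constructor=> _ [e [_ _ /(_ Eq)[_ Ee de] _] <-]; apply: IHn Ee.
    exact: leq_trans de _.
  move=> q; have [n] := ubnP (d2 q); elim: n q => [q|n IHn q qn]; first by rewrite ltn0.
  have [|nq] := pselect (reach E q); first exact: Racc.
  constructor=> _ [e [_ _ _ /(_ nq)[+|de]] <-]; first exact: Racc.
  by apply: IHn; exact: leq_trans de _.
(* The tree path to [q] is the tree path to the source of a chosen parent edge, followed by that
   edge. Only the basepoint has no parent and gets the empty path. *)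
pose F q (rec : forall p, R p q -> seq (edge Y)) :=
  match pselect (exists e, parent e q) with
  | left ex => let (e, eq) := cid ex in rcons (rec (src e) (ex_intro2 _ _ e eq erefl)) e
  | right _ => [::]
  end.
pose s := Fix R_wf (fun=> seq (edge Y)) F.
have sE q : s q = F q (fun p _ => s p).
  apply: (Fix_eq R_wf (fun=> seq (edge Y)) F) => {}q f g fg.
  by rewrite /F; case: pselect => // ex; case: cid => e eq; rewrite fg.
have sP q : q <> b -> exists2 e, parent e q & s q = rcons (s (src e)) e.
  move=> /parentP ex; rewrite sE /F; case: pselect => // {}ex.
  by case: cid => e eq; exists e.
have s1 : s b = [::] by rewrite sE /F; case: pselect => // -[e []].
exists (fun q => path_label (s q)); first by rewrite s1 /path_label big_nil.
move=> q; exists (s q).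
  elim: q / (R_wf q) => q _ IHq; have [->|qb] := pselect (q = b); first by rewrite s1.
  have [e eq ->] := sP q qb; rewrite -cats1; apply: is_path_cat (IHq _ _) _; first by exists e.
  by case: eq.
elim: q / (R_wf q) => q _ IHq; have [->|qb] := pselect (q = b).
  by rewrite s1; split=> // _; constructor.
have [e eq se] := sP q qb; have [tree srcE] := IHq _ (ex_intro2 _ _ e eq erefl).
case: (eq) => tq _ qE _; rewrite se -cats1; split.
  apply/List.Forall_app; split=> //; constructor=> //=.
  by rewrite /chord tq se -cats1 /path_label big_cat big_seq1 mulgV.
by move=> /qE[eE /srcE ? _]; apply/List.Forall_app; split=> //; constructor.
Qed.

(** Paths need not be reduced, which makes concatenation immediate; free reduction stays in [E] and
    keeps the label. *)
Definition loops (E : set (edge Y)) : set G := @path_label _ _ Y @`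
  [set s | is_path (basepoint Y) s (basepoint Y) /\ List.Forall E s].

(** The label being in [C] selects an orientation of each edge, and [g <> 1] discards the tree
    edges. For a fixed [t] the set grows with [E], which is what yields free factors. *)
Definition chords t (E : set (edge Y)) : set G :=
  [set g | g <> 1 /\ exists e, [/\ E e, C (label e) & chord t e = g]].

Section ChordBasis.

Variables (t : vertex Y -> G) (E : set (edge Y)).
Hypotheses (C_inj : injective (free_lift (fun c : C => val c)))
  (Y_det : deterministic Y) (t1 : t (basepoint Y) = 1)
  (tree : forall q, exists2 s, is_path (basepoint Y) s q &
    List.Forall [set e | chord t e = 1] s /\ (reach E q -> List.Forall E s))
  (EV : forall e, E e -> E (inv_edge Y e))
  (E_reach : forall e, E e -> reach E (src e)).

Local Notation D := (chords t E).
Local Notation val_lift := (free_lift (fun c : D => val c)).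

(** The default 1 is what a tree edge must read: its chord is 1, which is not in [D]. *)
Let gen g : free_group D :=
  if pselect (D g) is left Dg then free_gen (exist _ g (mem_set Dg)) else 1.

(** An edge whose label is not in [C] is read through its inverse edge, since [D] only records
    chords of edges labelled in [C]. *)
Let rho e : free_group D :=
  if pselect (C (label e)) then gen (chord t e) else (gen (chord t e)^-1)^-1.

Let rhoV : edge_weight rho.
Proof.
move=> e; rewrite /rho label_inv edge_weight_chord invgK.
case: pselect => [Ce'|nCe']; case: pselect => [Ce|nCe] //.
- by case: (basis_notinv C_inj Ce).
- by rewrite invgK.
- by case: (label_in e).
Qed.

Let rho_tree e : chord t e = 1 -> rho e = 1.
Proof.
rewrite /rho => ->; have gen1 : gen 1 = 1 by rewrite /gen; case: pselect => // -[].
by case: (pselect (C (label e))) => ?; rewrite ?invg1 gen1 ?invg1.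
Qed.

Let rho_chord e : E e -> val_lift (rho e) = chord t e.
Proof.
have genE e' : E e' -> C (label e') -> val_lift (gen (chord t e')) = chord t e'.
  move=> Ee' Ce'; rewrite /gen; case: pselect => [De'|nDe']; first by rewrite free_lift_gen.
  rewrite gmulf1; have [->|c1] := pselect (chord t e' = 1); first by [].
  by case: nDe'; split=> //; exists e'.
move=> Ee; rewrite /rho; case: pselect => [Ce|nCe]; first exact: genE.
rewrite gmulfV/= -(edge_weight_chord t e) genE ?edge_weight_chord ?invgK//; first exact: EV.
by rewrite label_inv; case: (label_in e).
Qed.

Let rho_path s : List.Forall E s -> is_path (basepoint Y) s (basepoint Y) ->
  val_lift (\prod_(e <- s) rho e) = path_label s.
Proof.
move=> sE /(prod_chord t); rewrite t1 mul1g invg1 mulg1 => <-.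
rewrite gmulf_prod; elim: sE => [|e s' Ee _ IH]; first by rewrite !big_nil.
by rewrite !big_cons IH /= rho_chord.
Qed.

Let rho_loop (c : D) : exists s, [/\ is_path (basepoint Y) s (basepoint Y),
  List.Forall E s & \prod_(e <- s) rho e = free_gen c].
Proof.
have [c1 [e [Ee Ce ec]]] := set_mem (valP c).
have [s sp [s1 sE]] := tree (src e); have [s' s'p [s'1 s'E]] := tree (tgt e).
(* The loop through the tree whose only edge outside the two tree paths is [e]; the tree paths read
   as 1. *)
exists (s ++ e :: inv_path s'); split.
- by apply: is_path_cat sp _; split=> //; exact: is_path_inv.
- apply/List.Forall_app; split; first exact/sE/E_reach.
  constructor=> //; apply: Forall_inv_path => //.
  by apply/s'E/reach_tgt => //; exact: E_reach.
have rho1 s0 : List.Forall [set e | chord t e = 1] s0 -> \prod_(e <- s0) rho e = 1.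
  elim=> [|e0 s0' e01 _ IH]; first by rewrite big_nil.
  by rewrite big_cons IH rho_tree ?mulg1.
rewrite big_cat big_cons /= edge_weight_inv// !rho1// mul1g invg1 mulg1.
rewrite /rho ec; case: (pselect (C (label e))) => // ?.
rewrite /gen; case: pselect => [Dc|[]]; last exact: set_mem (valP c).
by congr free_gen; exact: val_inj.
Qed.

Let rho_surj (w : free_group D) : exists s, [/\ is_path (basepoint Y) s (basepoint Y),
  List.Forall E s & \prod_(e <- s) rho e = w].
Proof.
rewrite -(free_lift_id w) /free_lift.
elim: (word w) => [|[c b] l [s [sp sE sl]]].
  by exists [::]; split; rewrite ?big_nil//; constructor.
have [s' [s'p s'E s'c]] := rho_loop c.
exists ((if b then s' else inv_path s') ++ s); split.
- by apply: is_path_cat sp; case: b => //; exact: is_path_inv.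
- by apply/List.Forall_app; split=> //; case: b => //; exact: Forall_inv_path.
by rewrite big_cat big_cons /= sl; case: b => //=; rewrite ?edge_weight_inv// s'c.
Qed.

(* [rho] reads a closed path as a word in the chords. The reading is unchanged by
   free reduction, and a closed path with trivial label reduces to the empty path. *)
Lemma chords_basis : is_basis (loops E) D.
Proof.
split.
  apply: gmulf_inj => w w1; have [s [sp sE sw]] := rho_surj w.
  have [s' [s'r s'p s'E s's]] := path_reduce sp sE.
  have s'1 : path_label s' = 1.
    by rewrite [LHS](s's _ _ edge_weight_label) -[LHS](rho_path sE sp) sw.
  suff s'0 : s' = [::] by rewrite -sw -s's// s'0 big_nil.
  apply: (reduced_path_uniq C_inj Y_det s'p (erefl : is_path (basepoint Y) [::] _)) => //.
    by case.
  by rewrite s'1 /path_label big_nil.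
apply/seteqP; split=> [_ [w _ <-]|_ [s [sp sE] <-]].
  by have [s [sp sE <-]] := rho_surj w; exists s => //; rewrite rho_path.
by exists (\prod_(e <- s) rho e) => //; exact: rho_path.
Qed.

End ChordBasis.

Lemma stallings_loops H : stallings_graph H Y -> loops setT = H.
Proof.
move=> [_ <-]; apply/seteqP; split=> [_ [s [sp sT] <-]|_ [s [sp _] <-]].
  have [s' [s'r s'p _ s's]] := path_reduce sp sT.
  by exists s' => //; exact: s's edge_weight_label.
by exists s => //; split=> //; exact: Forall_setT.
Qed.

End Chords.

(** * Images of automaton homomorphisms *)

Section HomImage.

Variables (G : groupType) (C : set G) (X Y : automaton C) (f : automaton_hom X Y).

Lemma hom_path p q s : is_path p s q ->
  is_path (hom_vertex f p) (map (hom_edge f) s) (hom_vertex f q).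
Proof.
elim: s p => /= [p ->//|e s IHs p [<- /IHs es]].
by rewrite hom_src hom_tgt.
Qed.

Lemma hom_Forall s : List.Forall (range (hom_edge f)) (map (hom_edge f) s).
Proof. by elim: s => [|e s IHs]; constructor=> //; exists e. Qed.

Lemma hom_path_label s : path_label (map (hom_edge f) s) = path_label s.
Proof. by rewrite /path_label big_map; apply: eq_bigr => e _; exact: hom_label. Qed.

Lemma hom_inv_edge e : deterministic Y ->
  hom_edge f (inv_edge X e) = inv_edge Y (hom_edge f e).
Proof.
move=> Y_det; apply: Y_det; first by rewrite hom_label !label_inv hom_label.
by left; rewrite hom_src !src_inv hom_tgt.
Qed.

Lemma hom_onto_loops : injective (free_lift (fun c : C => val c)) ->
  is_stallings Y -> loops (Y := Y) setT `<=` loops (range (hom_edge f)) -> hom_onto f.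
Proof.
move=> C_inj [_ Y_det [Y_vertex Y_edge]] loopsf.
have closedf s : reduced_closed s -> List.Forall (range (hom_edge f)) s.
  move=> [sp sr]; have [|s0 [s0p s0f] s0s] := loopsf (path_label s).
    by exists s => //; split=> //; exact: Forall_setT.
  have [s' [s'r s'p s'f s's]] := path_reduce s0p s0f.
  suff -> : s = s' by [].
  apply: (reduced_path_uniq C_inj Y_det sp s'p sr s'r).
  by rewrite -s0s; apply/esym/s's/edge_weight_label.
have edgef e : range (hom_edge f) e.
  by have [s /closedf/List.Forall_forall] := Y_edge e; apply.
split; apply/seteqP; split=> // p _; have [s _ [->|[e _ ep]]] := Y_vertex p.
  by exists (basepoint X) => //; exact: hom_basepoint.
have [e' _ e'e] := edgef e; case: ep => <-; rewrite -e'e.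
  by exists (src e') => //; rewrite hom_src.
by exists (tgt e') => //; rewrite hom_tgt.
Qed.

End HomImage.

(** * The implications between algebraicity and surjectivity *)

Lemma algebraic_hom_onto (G1 G2 : groupType) (phi : UMagmaMorphism.type G1 G2)
    (H K : set G1) (L C : set G2) : injective phi ->
  ~ (exists M, [/\ free_factor M K, M <> K & H `<=` M]) ->
  is_basis L C -> stallings_hom_onto C (phi @` H) (phi @` K).
Proof.
move=> phi_inj HK_alg [C_inj _] X Y [[X_conn _ _] XH] YK f.
have [Y_stal _] := YK; have [Y_conn Y_det _] := Y_stal.
apply: hom_onto_loops => //; rewrite (stallings_loops YK).
set E := range (hom_edge f).
have EV e : E e -> E (inv_edge Y e).
  by move=> [e' _ <-]; rewrite -hom_inv_edge//; exists (inv_edge X e').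
have E_reach e : E e -> reach E (src e).
  move=> [e' _ <-]; have [s sp] := X_conn (basepoint X) (src e').
  exists (map (hom_edge f) s); last exact: hom_Forall.
  by rewrite hom_src -(hom_basepoint f); exact: hom_path.
have [t t1 tree] := spanning_tree E Y_conn.
(* The same [t] is used for [E] and for the whole graph, so the first basis is contained in the
   second. *)
have [E_basis T_basis] : is_basis (loops E) (chords t E) /\
    is_basis (phi @` K) (chords t setT).
  split; first exact: chords_basis.
  rewrite -(stallings_loops YK); apply: chords_basis => //.
    by move=> q; have [s ? [? _]] := tree q; exists s => //; split=> // _; exact: Forall_setT.
  move=> e _; have [s sp] := Y_conn (basepoint Y) (src e).
  by exists s => //; exact: Forall_setT.
have E_phi : loops E `<=` phi @` K.
  rewrite -(stallings_loops YK) => _ [s [sp _] <-]; exists s => //; split=> //.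
  exact: Forall_setT.
have phiK : phi @^-1` (phi @` K) = K.
  by apply/seteqP; split=> x; [case=> y ? /phi_inj <-|exists x].
have [<-|MK] := pselect (phi @^-1` (loops E) = K).
  by move=> _ [x xE <-].
case: HK_alg; exists (phi @^-1` (loops E)); split=> //.
  exists (phi @^-1` (chords t E)), (phi @^-1` (chords t setT)); split.
  - by apply: basis_preimage => // _ /E_phi[x _ <-]; exists x.
  - by rewrite -[X in is_basis X]phiK; apply: basis_preimage => // _ [x _ <-]; exists x.
  - by move=> x [x1 [e [_ Ce ex]]]; split=> //; exists e.
move=> h Hh; have : (phi @` H) (phi h) by exists h.
rewrite -XH => -[s [sp _] sh]; exists (map (hom_edge f) s).
  split; last exact: hom_Forall.
  by rewrite -(hom_basepoint f); exact: hom_path.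
by rewrite hom_path_label.
Qed.

Lemma label_wordS (G : groupType) (C D : set G) w : C `<=` D ->
  label_word C w -> label_word D w.
Proof. by move=> CD [wC wr]; split=> // a /wC[]/CD; [left|right]. Qed.

Lemma hom_onto_algebraic (G : groupType) (H K : set G) :
  subgroup H -> subgroup K -> H `<=` K ->
  (forall C, is_basis K C -> stallings_hom_onto C H K) ->
  ~ exists M, [/\ free_factor M K, M <> K & H `<=` M].
Proof.
move=> sH sK HK onto [M [[C [D [MC KD CD]]] MK HM]]; apply: MK.
suff DC : D `<=` C by rewrite -MC.2 -KD.2; have -> : C = D by exact/seteqP.
move=> d Dd; have [D_inj _] := KD.
(* The hypothesis [onto] quantifies over Stallings graphs and homomorphisms, so actual ones must be
   supplied. *)
have [X [Y [f [XH YK]]]] := stallings_hom_exists KD sH sK HK (@subset_refl _ K).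
have [_ f_onto] := onto D KD X Y XH YK f.
have [[_ Y_det _] YKE] := YK; have [[_ X_det [_ X_edge]] XHE] := XH.
(* The one-letter word [d] is reduced, so the reduced closed path of [Y] with value [d] is a single
   edge labelled [d]. *)
have d_word : label_word D [:: d].
  by split=> [a [<-|[]]|[|? []]//]; left.
have [s [sp sr] sd] : (path_label (X := Y) @` [set s | reduced_closed s]) d.
  rewrite YKE -KD.2; exists (free_gen (exist _ d (mem_set Dd))) => //.
  by rewrite free_lift_gen.
have : map (@label _ _ Y) s = [:: d].
  apply: (label_word_uniq D_inj) => //; first exact: label_word_path sp sr.
  by rewrite big_map big_seq1.
case: s sp sr sd => // e [|//] _ _ _ [ed].
have [e' _ e'e] : range (hom_edge f) e by rewrite f_onto.
have [s [sp sr] e's] := X_edge e'.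
have Hs : M (path_label s) by apply: HM; rewrite -XHE; exists s.
have [w wC ws] := basis_word MC Hs.
(* The path label and the word over [C] are both reduced over [D], so they agree letter by
   letter. *)
have sw : map (@label _ _ X) s = w.
  apply: (label_word_uniq D_inj); [exact: label_word_path sp sr|exact: label_wordS wC|].
  by rewrite ws big_map.
have wd : List.In d w by rewrite -sw -ed -e'e hom_label; exact: List.in_map.
(* The letter [d] or its inverse lies in [C]; the second case would put both in the basis [D]. *)
by case: (wC.1 d wd) => // /CD /(basis_notinv D_inj Dd).
Qed.

Theorem proposition2p1 (A : Type) (H K : set (free_group A))
  (subgroupH : subgroup H) (subgroupK : subgroup K) (subHK : H `<=` K) :
  [<->
    ~ exists M : set (free_group A),
        [/\ free_factor M K, M <> K & H `<=` M];
    forall (B : Type) (phi : {multiplicative free_group A -> free_group B}),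
      injective phi ->
      forall L : set (free_group B), subgroup L -> phi @` K `<=` L ->
      forall C : set (free_group B), is_basis L C ->
      stallings_hom_onto C (phi @` H) (phi @` K);
    forall (B : Type) (i : A -> B), injective i ->
      forall L : set (free_group B), subgroup L -> free_map i @` K `<=` L ->
      forall C : set (free_group B), is_basis L C ->
      stallings_hom_onto C (free_map i @` H) (free_map i @` K);
    forall L : set (free_group A), subgroup L -> K `<=` L ->
      forall C : set (free_group A), is_basis L C ->
      stallings_hom_onto C H K;
    forall C : set (free_group A), is_basis K C -> stallings_hom_onto C H K ].
Proof.
tfae.
- move=> HK_alg B phi phi_inj L _ _ C LC.
  (* Preserving products forces preserving quotients, so [phi] can be repackaged as a group
     morphism. *)
  have phiF : {morph (phi : _ -> _) : u v / u / v}.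
    by move=> u v; apply: (mulIg (phi v)); rewrite -gmulfM !mulgVK.
  pose psi : UMagmaMorphism.type _ _ := HB.pack (phi : _ -> _)
    (isGroupMorphism.Build _ _ (phi : _ -> _) phiF).
  exact: (@algebraic_hom_onto _ _ psi _ _ L).
- move=> onto B i i_inj L sL KL C LC.
  exact: (onto B (free_map i) (free_map_inj i_inj) L).
- move=> onto L sL KL C LC.
  (* Specializing to [B = A] and the identity embedding, which fixes every subset. *)
  have map_id (S : set (free_group A)) : free_map id @` S = S.
    by rewrite -[RHS]image_id; apply: eq_imagel => w _; exact: free_lift_id.
  by have := onto A id (@inj_id A) L sL; rewrite !map_id; apply.
- by move=> onto; exact: onto K subgroupK (@subset_refl _ K).
- exact: hom_onto_algebraic.
Qed.
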